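(* Let $G$ and $H$ be graphs on the same vertex set $V$ with $|V|\geq 6$, both $2$-connected and outerplanar. If $G$ and $H$ have the same set of connected triples, then $G=H$.
   Context: All graphs are finite and simple. A connected triple of a graph $G$ is a $3$-element subset $\{a,b,c\}\subseteq V(G)$ such that $G[\{a,b,c\}]$ is connected. A graph is $k$-connected if it has more than $k$ vertices and cannot be disconnected by removing fewer than $k$ vertices. Graphs are labelled: equality means equal edge sets. *)

(* Defs.v *)
From HB Require Import structures.
From mathcomp Require Import all_boot all_order all_algebra.
From mathcomp Require Import all_classical all_reals all_analysis.
Set Implicit Arguments.
Unset Strict Implicit.
Unset Printing Implicit Defensive.
Import Order.TTheory GRing.Theory Num.Theory.
Import numFieldNormedType.Exports.

Record sgraph (V : finType) := SGraph {
  adj :> rel V;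
  adj_sym : symmetric adj;
  adj_irrefl : irreflexive adj }.

Section Graphs.
Variables (V : finType) (G : sgraph V).

Definition edges : {set {set V}} :=
  [set [set p.1; p.2] | p in [set p : V * V | adj G p.1 p.2]]%SET.

Definition induced_rel (S : {set V}) : rel V :=
  [rel x y | [&& x \in S, y \in S & adj G x y]].

Definition induces_connected (S : {set V}) : bool :=
  (S != finset.set0) &&
  [forall x in S, forall y in S, connect (induced_rel S) x y].

Definition connected_triples : {set {set V}} :=
  [set S : {set V} | (#|S| == 3) && induces_connected S]%SET.

Definition k_connected (k : nat) : Prop :=
  k < #|V| /\ forall X : {set V}, #|X| < k -> induces_connected (~: X)%SET.

End Graphs.

Local Open Scope classical_set_scope.
Local Open Scope ring_scope.

Section Drawings.
Variable R : realType.
Notation plane := (R * R)%type.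

Definition is_arc (A : set plane) (p q : plane) : Prop :=
  exists f : R -> plane,
    [/\ {within `[0, 1], continuous f},
        {in `[0, 1] &, injective f},
        f 0 = p, f 1 = q & A = f @` `[0, 1]].

Variables (V : finType) (G : sgraph V).

(* The point [pt v] represents the vertex [v]; [curve e] is the closed arc
   (endpoints included) representing the edge [e]. *)
Definition arc_interior (pt : V -> plane) (curve : {set V} -> set plane)
    (e : {set V}) : set plane :=
  curve e `\` pt @` [set v | v \in e].

Definition plane_drawing (pt : V -> plane) (curve : {set V} -> set plane) :
    Prop :=
  [/\ injective pt,
      forall x y, adj G x y -> is_arc (curve [set x; y]%SET) (pt x) (pt y),
      forall e, e \in edges G ->
        arc_interior pt curve e `&` range pt = set0
    & forall e e', e \in edges G -> e' \in edges G -> e != e' ->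
        arc_interior pt curve e `&` curve e' = set0].

Definition drawn_set (pt : V -> plane) (curve : {set V} -> set plane) :
    set plane :=
  range pt `|` \bigcup_(e in [set e | e \in edges G]) curve e.

Definition is_face (D F : set plane) : Prop :=
  exists2 p, (~` D) p & F = connected_component (~` D) p.

Definition boundary (A : set plane) : set plane := closure A `\` interior A.

Definition outerplanar : Prop :=
  exists (pt : V -> plane) (curve : {set V} -> set plane),
    plane_drawing pt curve /\
    exists F : set plane,
      [/\ is_face (drawn_set pt curve) F,
          ~ bounded_set F
        & forall v, boundary F (pt v)].

End Drawings.

(* Main.v *)
(** The topological input is that an outerplanar graph has no [K_{2,3}] minor
  in which two of the branch sets are the single vertices [x], [y] of degree 3.
  The three other branch sets give three compact "sides" meeting only in [x]
  and [y]; a face adjacent to all of them provides a third centre, hence a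
  drawing of [K_{3,3}].  That [K_{3,3}] has no drawing is shown by counting
  mod 2 how often the vector [f s - g t] between two independent edges [f], [g]
  turns across a fixed ray: it does so an even number of times around the
  boundary of the square of parameters [(s, t)], and summing this over the
  pairs of independent edges leaves an odd number.

  Now let [ab] be an edge of [G] but not of [H].  Comparing the triples
  [{a, b, c}], the neighbours of [a] or [b] in [G] outside [{a, b}] are the
  common neighbours of [a] and [b] in [H], so they are exactly two vertices
  [x], [y].  If one of [ax], [ay], [bx], [by] were missing from [G], then
  comparing triples shows that in [H] all but one of the other vertices would
  be separated from the rest by a single vertex, which is impossible since
  there are at least two of them.  So all four edges are in [G], and the rest
  of [G] is a third connection between [x] and [y]: a [K_{2,3}] minor. *)

Require Import Defs.
From mathcomp Require Import all_boot all_order all_algebra.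
From mathcomp Require Import all_classical all_reals all_analysis.
From mathcomp Require Import lra.

Set Implicit Arguments.
Unset Strict Implicit.
Unset Printing Implicit Defensive.
Import Order.TTheory GRing.Theory Num.Theory.
Import numFieldNormedType.Exports.
Local Open Scope classical_set_scope.
Local Open Scope ring_scope.

(** * Counting crossings of a ray *)

Section RayCrossings.
Variable R : realType.
Notation plane := (R * R)%type.
Implicit Types u v w a b : plane.

Definition dot u v : R := u.1 * v.1 + u.2 * v.2.
Definition det u v : R := u.1 * v.2 - u.2 * v.1.

(** Half-open half-plane of the directions with angle in [0, pi): when [u] is nonzero, exactly one
    of [u] and [- u] lies in it. *)
Definition upper u : bool := (0 < u.2) || ((u.2 == 0) && (0 < u.1)).

(* For [u], [v] with [0 < dot u v]: whether the short turn from [u] to [v]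
   crosses the ray of positive abscissas. *)
Definition crosses u v : bool :=
  (upper u (+) upper v) && (upper u == (det u v < 0)).

Lemma detC u v : det u v = - det v u.
Proof. by rewrite /det; lra. Qed.

Lemma dotC u v : dot u v = dot v u.
Proof. by rewrite /dot; lra. Qed.

Lemma detN u v : det (- u) (- v) = det u v.
Proof. by rewrite /det /= !mulrNN. Qed.

Lemma dotN u v : dot (- u) (- v) = dot u v.
Proof. by rewrite /dot /= !mulrNN. Qed.

Lemma dot_gt0_neq0 u v : 0 < dot u v -> u != 0.
Proof.
case: u v => u1 u2 [v1 v2]; apply: contraTneq => -[-> ->].
by rewrite /dot /= !mul0r addr0 ltxx.
Qed.

Lemma dot_self_gt0 u : u != 0 -> 0 < dot u u.
Proof.
case: u => u1 u2; rewrite xpair_eqE /dot /= negb_and => /orP[] h.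
  by apply: ltr_pwDl; [rewrite -expr2 exprn_even_gt0|rewrite -expr2 sqr_ge0].
by apply: ltr_wpDl; [rewrite -expr2 sqr_ge0|rewrite -expr2 exprn_even_gt0].
Qed.

Lemma upperN u : u != 0 -> upper (- u) = ~~ upper u.
Proof.
case: u => u1 u2; rewrite /upper /= xpair_eqE /= oppr_gt0 oppr_eq0 oppr_gt0.
by case: (ltgtP u2 0); case: (ltgtP u1 0).
Qed.

(** Negation trades the positive ray for the negative one. A short turn crosses exactly one of the
    two if its ends lie in different half-planes, and neither otherwise. *)
Lemma crossesN u v : u != 0 -> v != 0 ->
  crosses (- u) (- v) = crosses u v (+) (upper u (+) upper v).
Proof.
move=> u0 v0; rewrite /crosses !upperN // detN.
by case: (upper u); case: (upper v); case: (det u v < 0).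
Qed.

Lemma upper_scale p a : upper a -> 0 <= p ->
  0 <= p * a.2 /\ (p * a.2 = 0 -> 0 <= p * a.1).
Proof.
rewrite /upper => ua p0.
have a2 : 0 <= a.2 by case/orP: ua => [/ltW //|/andP[/eqP -> _]].
split; first exact: mulr_ge0.
move/eqP; rewrite mulf_eq0 => /orP[/eqP ->|a20]; first by rewrite mul0r.
by case/orP: ua => [|/andP[_ /ltW a1]]; [rewrite (eqP a20) ltxx|exact: mulr_ge0].
Qed.

(** If [det b w <= 0], then [det a b] times [w] is a combination of [a] and [b] with nonnegative
    coefficients, so [w] would be upper as well. In the degenerate case [det a b = 0], the vector
    [b] is a positive multiple of [w]. *)
Lemma det_upper_lower a b w : upper a -> upper b -> ~~ upper w ->
  0 < dot a w -> 0 < dot b w -> 0 <= det a w -> 0 < det b w.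
Proof.
move=> ua ub lw aw bw daw; rewrite ltNge; apply/negP => dbw.
have [p0 q0] : 0 <= - det b w /\ 0 <= det a w by rewrite oppr_ge0.
have [A1 A2] := upper_scale ua p0; have [B1 B2] := upper_scale ub q0.
have e1 : det a b * w.1 = - det b w * a.1 + det a w * b.1 by rewrite /det; lra.
have e2 : det a b * w.2 = - det b w * a.2 + det a w * b.2 by rewrite /det; lra.
have e3 : det a b * (dot w w) = - det b w * dot a w + det a w * dot b w.
  by rewrite /det /dot; lra.
have w0 : w != 0 by apply: (@dot_gt0_neq0 _ a); rewrite dotC.
have ww := dot_self_gt0 w0.
have pw : 0 <= - det b w * dot a w by rewrite mulr_ge0 // ltW.
have qw : 0 <= det a w * dot b w by rewrite mulr_ge0 // ltW.
have d0 : 0 <= det a b by rewrite -(pmulr_lge0 _ ww); lra.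
have w2 : w.2 <= 0.
  by rewrite leNgt; apply: contra lw => h; rewrite /upper h.
have [dab|dab] := ltP 0 (det a b).
  have w2' : 0 <= w.2 by rewrite -(pmulr_rge0 _ dab); lra.
  have w20 : w.2 = 0 by lra.
  rewrite w20 mulr0 in e2.
  have w1 : 0 <= w.1 by rewrite -(pmulr_rge0 _ dab) e1 addr_ge0; lra.
  move: lw w0; rewrite /upper w20 ltxx eqxx /= -leNgt => w1'.
  have -> : w = (w.1, w.2) by case: (w).
  by rewrite w20 xpair_eqE eqxx andbT; lra.
have dab0 : det a b = 0 by lra.
rewrite dab0 mul0r in e3.
have b0 : - det b w = 0.
  have /eqP : - det b w * dot a w = 0 by lra.
  by rewrite mulf_eq0 (gt_eqF aw) orbF => /eqP.
have {}b0 : det b w = 0 by lra.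
have bb1 : dot b w * w.1 = dot w w * b.1.
  have : dot b w * w.1 = dot w w * b.1 - w.2 * det b w by rewrite /det /dot; lra.
  by rewrite b0 mulr0 subr0.
have bb2 : dot b w * w.2 = dot w w * b.2.
  have : dot b w * w.2 = dot w w * b.2 + w.1 * det b w by rewrite /det /dot; lra.
  by rewrite b0 mulr0 addr0.
have b2 : 0 <= b.2 by case/orP: ub => [/ltW //|/andP[/eqP -> _]].
have w2' : 0 <= w.2 by rewrite -(pmulr_rge0 _ bw) bb2 mulr_ge0 // ltW.
have w20 : w.2 = 0 by lra.
have b20 : b.2 = 0.
  have /esym/eqP := bb2; rewrite w20 mulr0.
  by rewrite mulf_eq0 (gt_eqF ww) => /eqP.
move: ub lw; rewrite /upper b20 w20 ltxx eqxx /= => b1; rewrite -leNgt => w1.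
have : 0 < dot w w * b.1 by exact: mulr_gt0.
by rewrite -bb1 pmulr_rgt0 // ltNge w1.
Qed.

(** Negating all vectors reduces to [a] and [b] upper; [det_upper_lower] is then used in both
    orders. Taking [a] for both upper vectors excludes [det a w = 0]. *)
Lemma det_lt0_sep a b w : upper a = upper b -> upper a != upper w ->
  0 < dot a w -> 0 < dot b w ->
  [/\ (det a w < 0) = (det b w < 0), (det w a < 0) = ~~ (det a w < 0)
    & (det w b < 0) = ~~ (det b w < 0)].
Proof.
wlog ua : a b w / upper a.
  move=> hw; have [ua|la] := boolP (upper a); first by rewrite -ua; apply: hw.
  move=> ab lw aw bw.
  have a0 := dot_gt0_neq0 aw; have b0 := dot_gt0_neq0 bw.
  have w0 : w != 0 by apply: (@dot_gt0_neq0 _ a); rewrite dotC.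
  have := hw (- a) (- b) (- w); rewrite !upperN // -ab !detN !dotN la.
  by apply => //; rewrite eqb_negLR negbK eq_sym; case: (upper w) lw.
rewrite ua => /esym ub lw aw bw; have {}lw : ~~ upper w by case: (upper w) lw.
have ab := det_upper_lower ua ub lw aw bw.
have ba := det_upper_lower ub ua lw bw aw.
have aa := det_upper_lower ua ua lw aw aw.
have bb := det_upper_lower ub ub lw bw bw.
split; first by apply/idP/idP; rewrite !ltNge; apply: contra => h; apply: ltW; auto.
  rewrite detC oppr_lt0 -leNgt; apply/idP/idP; [exact: ltW|exact: aa].
rewrite detC oppr_lt0 -leNgt; apply/idP/idP; [exact: ltW|exact: bb].
Qed.

(** Unless all three vectors lie in one half-plane, one of them is separated from the other two. By
    [det_lt0_sep] the two turns at it pass across the same ray, and the third turn crosses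
    nothing. *)
Lemma crosses_triangle u v w : 0 < dot u v -> 0 < dot v w -> 0 < dot u w ->
  crosses u v (+) crosses v w (+) crosses u w = false.
Proof.
move=> uv vw uw; have vu := uv; have wv := vw; have wu := uw.
rewrite dotC in vu; rewrite dotC in wv; rewrite dotC in wu.
have H1 := @det_lt0_sep u v w; have H2 := @det_lt0_sep v w u.
have H3 := @det_lt0_sep u w v; rewrite /crosses.
move: H1 H2 H3; case: (upper u); case: (upper v); case: (upper w) => //= H1 H2 H3.
- by have [//|//|//|//|] := H1; do ![case: (_ < 0) => //].
- by have [//|//|//|//|] := H3; do ![case: (_ < 0) => //].
- by have [//|//|//|//|] := H2; do ![case: (_ < 0) => //].
- by have [//|//|//|//|] := H2; do ![case: (_ < 0) => //].
- by have [//|//|//|//|] := H3; do ![case: (_ < 0) => //].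
- by have [//|//|//|//|] := H1; do ![case: (_ < 0) => //].
Qed.

End RayCrossings.

(** * No drawing of [K_{3,3}] *)

Lemma fst_continuous (T U : topologicalType) : continuous (@fst T U).
Proof. by move=> z; exact: cvg_fst. Qed.

Lemma snd_continuous (T U : topologicalType) : continuous (@snd T U).
Proof. by move=> z; exact: cvg_snd. Qed.

Section CompleteBipartite.
Variable R : realType.
Notation plane := (R * R)%type.
Implicit Types (f g : R -> plane) (p q : plane).

(** Each inner edge of the grid belongs to two cells and cancels mod 2; [h] labels horizontal edges
    and [v] vertical ones. Each row of cells is summed first, then the rows are stacked. *)
Lemma grid_boundary (h v : nat -> nat -> bool) m n :
  (forall k l, (k < m)%N -> (l < n)%N ->
    h k l (+) v k.+1 l (+) (v k l (+) h k l.+1) = false) ->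
  \big[addb/false]_(k < m) h k 0%N (+) \big[addb/false]_(l < n) v m l (+)
  (\big[addb/false]_(l < n) v 0%N l (+) \big[addb/false]_(k < m) h k n) = false.
Proof.
move=> sq; have {sq} row l : (l < n)%N ->
    \big[addb/false]_(k < m) h k l (+) v m l (+)
    (v 0%N l (+) \big[addb/false]_(k < m) h k l.+1) = false.
  move=> ln; suff: forall i, (i <= m)%N ->
    \big[addb/false]_(k < i) h k l (+) v i l (+)
    (v 0%N l (+) \big[addb/false]_(k < i) h k l.+1) = false by apply.
  elim=> [|i IH] im; first by rewrite !big_ord0 addbF /= addbb.
  move/(_ i l im ln): sq; move: (IH (ltnW im)); rewrite !big_ord_recr /=.
  move: (h i l) (h i l.+1) (v i l) (v i.+1 l) (v 0%N l).
  move: (\big[addb/false]_(k < i) h k l) (\big[addb/false]_(k < i) h k l.+1).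
  by do 7!case.
elim: n row => [|n IH] row.
  by rewrite !big_ord0 !addbF addFb addbb.
rewrite !big_ord_recr /=; move: (row n (ltnSn n)) (IH (fun l ln => row l (ltnW ln))).
move: (v m n) (v 0%N n) (\big[addb/false]_(k < m) h k n).
move: (\big[addb/false]_(k < m) h k n.+1) (\big[addb/false]_(k < m) h k 0%N).
move: (\big[addb/false]_(l < n) v m l) (\big[addb/false]_(l < n) v 0%N l).
by do 7!case.
Qed.

Lemma addb_telescope (x : nat -> bool) n :
  \big[addb/false]_(l < n) (x l (+) x l.+1) = x 0%N (+) x n.
Proof.
elim: n => [|n IH]; first by rewrite big_ord0 addbb.
by rewrite big_ord_recr IH /=; do 3!case: (x _).
Qed.

(* Along [f] and [g] sampled with mesh [1/N], the vector [f s - g t] turns by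
   less than a quarter turn at each step. *)
Definition fine_mesh f g (N : nat) := forall s s' t t',
  s \in `[0, 1] -> s' \in `[0, 1] -> t \in `[0, 1] -> t' \in `[0, 1] ->
  `|s - s'| <= N%:R^-1 -> `|t - t'| <= N%:R^-1 ->
  0 < dot (f s - g t) (f s' - g t').

Definition turns f N p : bool :=
  \big[addb/false]_(k < N)
    crosses (f (k%:R / N%:R) - p) (f (k.+1%:R / N%:R) - p).

(** The vector [f s - g t] is followed around the square of parameters. On the sides where [s] is
    fixed, [turns g] sees the opposite vector; the corrections from [crossesN] telescope to the
    [upper] terms at the corners. *)
Lemma cell_turns f g N : (0 < N)%N -> fine_mesh f g N ->
  turns f N (g 0) (+) turns f N (g 1) (+) (turns g N (f 0) (+) turns g N (f 1))
  (+) (upper (g 0 - f 0) (+) upper (g 1 - f 0)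
  (+) (upper (g 0 - f 1) (+) upper (g 1 - f 1))) = false.
Proof.
move=> N0 fine; pose r k : R := k%:R / N%:R.
have r0 : r 0%N = 0 by rewrite /r mul0r.
have rN : r N = 1 by rewrite /r divff // pnatr_eq0 -lt0n.
have rI k : (k <= N)%N -> r k \in `[0, 1].
  move=> kN; rewrite in_itv /= divr_ge0 //= ler_pdivrMr ?ltr0n // mul1r.
  by rewrite ler_nat.
have rS k : `|r k - r k.+1| <= N%:R^-1.
  by rewrite /r -mulrBl -natr1 opprD addNKr mulN1r normrN ger0_norm ?invr_ge0.
have rr k : `|r k - r k| <= N%:R^-1 by rewrite subrr normr0 invr_ge0.
have rS' k : `|r k.+1 - r k| <= N%:R^-1 by rewrite distrC.
have flip p n : (forall k, (k <= n)%N -> g (r k) - p != 0) ->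
    \big[addb/false]_(l < n) crosses (p - g (r l)) (p - g (r l.+1)) =
    \big[addb/false]_(l < n) crosses (g (r l) - p) (g (r l.+1) - p)
      (+) (upper (g (r 0%N) - p) (+) upper (g (r n) - p)).
  move=> nz; rewrite -(addb_telescope (fun l => upper (g (r l) - p))) -big_split /=.
  apply: eq_bigr => l _; rewrite -crossesN ?opprB //; apply: nz.
    exact/ltnW.
  exact: ltn_ord.
have nzf k l : (k <= N)%N -> (l <= N)%N -> g (r l) - f (r k) != 0.
  move=> kN lN; rewrite -oppr_eq0 opprB.
  exact: dot_gt0_neq0 (fine _ _ _ _ (rI _ kN) (rI _ kN) (rI _ lN) (rI _ lN) _ _).
have := @grid_boundary (fun k l => crosses (f (r k) - g (r l)) (f (r k.+1) - g (r l)))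
  (fun k l => crosses (f (r k) - g (r l)) (f (r k) - g (r l.+1))) N N.
have sq k l : (k < N)%N -> (l < N)%N ->
    crosses (f (r k) - g (r l)) (f (r k.+1) - g (r l)) (+)
    crosses (f (r k.+1) - g (r l)) (f (r k.+1) - g (r l.+1)) (+)
    (crosses (f (r k) - g (r l)) (f (r k) - g (r l.+1)) (+)
    crosses (f (r k) - g (r l.+1)) (f (r k.+1) - g (r l.+1))) = false.
  move=> kN lN; have [k1 l1] := (rI _ (ltnW kN), rI _ (ltnW lN)).
  have [k2 l2] := (rI _ kN, rI _ lN).
  (* A diagonal cuts the cell into two triangles. *)
  have t1 : crosses (f (r k) - g (r l)) (f (r k.+1) - g (r l)) (+)
    crosses (f (r k.+1) - g (r l)) (f (r k.+1) - g (r l.+1)) (+)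
    crosses (f (r k) - g (r l)) (f (r k.+1) - g (r l.+1)) = false.
    by apply: crosses_triangle; apply: fine.
  have t2 : crosses (f (r k) - g (r l)) (f (r k) - g (r l.+1)) (+)
    crosses (f (r k) - g (r l.+1)) (f (r k.+1) - g (r l.+1)) (+)
    crosses (f (r k) - g (r l)) (f (r k.+1) - g (r l.+1)) = false.
    by apply: crosses_triangle; apply: fine.
  by move: t1 t2; do 5!case: (crosses _ _).
move/(_ sq); rewrite !flip; last 2 first.
- by move=> k kN; apply: nzf.
- by move=> k kN; apply: nzf.
rewrite -/(turns f N _) -/(turns f N _) -/(turns g N _) -/(turns g N _) r0 rN.
by do 4!case: (turns _ _ _); do 4!case: (upper _).
Qed.

Definition offdiag_sum (b : 'I_3 -> 'I_3 -> bool) : bool :=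
  \big[addb/false]_(j : 'I_3) \big[addb/false]_(l | l != j) b j l.

(** Each [x j] and each [y l] occurs for two ordered pairs and cancels, while the [d] terms
    contribute one for each of the three unordered pairs. *)
Lemma offdiag_sum_odd (b b' d : 'I_3 -> 'I_3 -> bool) (x y : 'I_3 -> bool) :
  (forall j l, l != j -> b j l (+) b' l j = x j (+) y l (+) d l j) ->
  (forall j l, l != j -> d l j = ~~ d j l) ->
  offdiag_sum b (+) offdiag_sum b' = true.
Proof.
move=> e dN; have -> : offdiag_sum b' =
    \big[addb/false]_(j : 'I_3) \big[addb/false]_(l | l != j) b' l j.
  rewrite /offdiag_sum (exchange_big_dep predT) //=; apply: eq_bigr => j _.
  by apply: eq_bigl => l; rewrite eq_sym.
rewrite -big_split /=.
under eq_bigr => j _ do rewrite -big_split /= (eq_bigr _ (e j)).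
under eq_bigr => j _ do rewrite big_mkcond /=.
rewrite !big_ord_recl !big_ord0 /=.
rewrite (dN (lift ord0 ord0) ord0) // (dN (lift ord0 (lift ord0 ord0)) ord0) //.
rewrite (dN (lift ord0 (lift ord0 ord0)) (lift ord0 ord0)) //.
by do 3!case: (x _); do 3!case: (y _); do 3!case: (d _ _).
Qed.

(** The product of [f s - g t] with itself is positive and stays so for nearby parameters;
    compactness of the square makes the mesh uniform. *)
Lemma fine_mesh_near f g : continuous f -> continuous g ->
  (forall s t, s \in `[0, 1] -> t \in `[0, 1] -> f s != g t) ->
  \forall N \near \oo, fine_mesh f g N.
Proof.
move=> cf cg fg.
have := @compact_setX R R _ _ (@segment_compact R 0 1) (@segment_compact R 0 1).
move/compact_near_coveringP => /(_ nat \oo (fun N (x : R * R) => forall s' t',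
  `|x.1 - s'| <= N%:R^-1 -> `|x.2 - t'| <= N%:R^-1 ->
  0 < dot (f x.1 - g x.2) (f s' - g t')) _) near_dot.
suff H : forall x : R * R, (`[0, 1]%classic `*` `[0, 1]%classic) x ->
    \forall x' \near x & N \near \oo, forall s' t',
    `|x'.1 - s'| <= N%:R^-1 -> `|x'.2 - t'| <= N%:R^-1 ->
    0 < dot (f x'.1 - g x'.2) (f s' - g t').
  apply: filterS (near_dot H) => N fineN s s' t t' sI s'I tI t'I ss' tt'.
  exact: (fineN (s, t)).
case=> s0 t0 [/= s0I t0I].
pose Phi (z : (R * R) * (R * R)) :=
  dot (f z.1.1 - g z.1.2) (f z.2.1 - g z.2.2).
have cPhi : {for ((s0, t0), (s0, t0)), continuous Phi}.
  have cc (F : (R * R) * (R * R) -> R * R) : continuous F ->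
      continuous (fun z => f (F z).1 - g (F z).2).
    move=> cF z.
    have c1 := continuous_comp (cF z) (@fst_continuous R R _).
    have c2 := continuous_comp (cF z) (@snd_continuous R R _).
    by apply: cvgB; [exact: (continuous_comp c1 (cf _))|exact: (continuous_comp c2 (cg _))].
  have c1 := cc fst (@fst_continuous (R * R)%type (R * R)%type).
  have c2 := cc snd (@snd_continuous (R * R)%type (R * R)%type).
  apply: cvgD; apply: cvgM.
  - exact: (continuous_comp (c1 _) (@fst_continuous R R _)).
  - exact: (continuous_comp (c2 _) (@fst_continuous R R _)).
  - exact: (continuous_comp (c1 _) (@snd_continuous R R _)).
  - exact: (continuous_comp (c2 _) (@snd_continuous R R _)).
have Phi0 : 0 < Phi ((s0, t0), (s0, t0)).
  by rewrite /Phi /= dot_self_gt0 // subr_eq0 fg.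
have /nbhs_ballP[eps /= eps0 He] :
    \forall z \near ((s0, t0), (s0, t0)), 0 < Phi z.
  exact: (cvgr_gt _ cPhi).
have e2 : 0 < eps / 2 by rewrite divr_gt0.
near=> x' N => s' t' ss' tt'.
apply: (He ((x'.1, x'.2), (s', t'))).
have [xs xt] : ball (s0, t0) (eps / 2) x' by near: x'; exact: nbhsx_ballx.
have N2 : N%:R^-1 < eps / 2.
  rewrite invf_plt ?posrE //; last by rewrite ltr0n; near: N; exact: nbhs_infty_gt.
  by near: N; exact: nbhs_infty_gtr.
have tri (a b c : R) : ball a (eps / 2) b -> `|b - c| <= N%:R^-1 -> ball a eps c.
  rewrite /ball /= => ab bc; rewrite (le_lt_trans (ler_distD b _ _)) //.
  by rewrite (splitr eps) ltrD // (le_lt_trans bc).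
have half (a b : R) : ball a (eps / 2) b -> ball a eps b.
  by apply: le_ball; rewrite ler_pdivrMr // ler_peMr ?ler1n // ltW.
split; split => /=; [exact: half|exact: half|exact: tri ss'|exact: tri tt'].
Unshelve. all: by end_near. Qed.

(** Summing [cell_turns] over the pairs [j != l] shows that [B i] and [B k] differ whenever
    [i != k], but there are no three pairwise different booleans. *)
Lemma K33_curves_meet (e : 'I_3 -> 'I_3 -> R -> plane) (P Q : 'I_3 -> plane) :
  (forall i j, continuous (e i j)) ->
  (forall i j, e i j 0 = P i) -> (forall i j, e i j 1 = Q j) ->
  ~ (forall i k j l s t, i != k -> j != l -> s \in `[0, 1] -> t \in `[0, 1] ->
      e i j s != e k l t).
Proof.
move=> ce e0 e1 dis.
have [N [N0 fine]] : exists N, (0 < N)%N /\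
    forall i k j l, i != k -> j != l -> fine_mesh (e i j) (e k l) N.
  suff: \forall N \near \oo, (0 < N)%N /\ forall x : 'I_3 * 'I_3 * ('I_3 * 'I_3),
      x.1.1 != x.1.2 -> x.2.1 != x.2.2 ->
      fine_mesh (e x.1.1 x.2.1) (e x.1.2 x.2.2) N.
    case/filter_ex => N [N0 fine]; exists N; split=> // i k j l.
    exact: (fine (i, k, (j, l))).
  apply: filterI; first exact: nbhs_infty_gt.
  pose fine_at (x : 'I_3 * 'I_3 * ('I_3 * 'I_3)) N :=
    x.1.1 != x.1.2 -> x.2.1 != x.2.2 ->
    fine_mesh (e x.1.1 x.2.1) (e x.1.2 x.2.2) N.
  apply: (@filter_forall nat _ fine_at (nbhs \oo) _) => x; rewrite /fine_at.
  have [->|xi] := eqVneq x.1.1 x.1.2; first exact: filterE.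
  have [->|xj] := eqVneq x.2.1 x.2.2; first exact: filterE.
  have := fine_mesh_near (ce x.1.1 x.2.1) (ce x.1.2 x.2.2).
  move/(_ (fun s t => dis _ _ _ _ s t xi xj)).
  by apply: filterS.
have Qdis j l : j != l -> Q l - Q j != 0.
  move=> jl; rewrite subr_eq0 -(e1 ord0) -(e1 ord_max).
  by apply: dis; rewrite ?in_itv /= ?lexx ?ler01 // eq_sym.
pose B i := offdiag_sum (fun j l => turns (e i j) N (Q l)).
have BB i k : i != k -> B i (+) B k = true.
  (* The remaining terms of [cell_turns] depend on [j] alone or on [l] alone, except for
     [upper (Q l - Q j)], which flips when [j] and [l] are exchanged. *)
  move=> ik; apply: (@offdiag_sum_odd _ _ (fun l j => upper (Q l - Q j))
    (fun j => turns (e i j) N (P k) (+) upper (P k - Q j) (+) upper (P k - P i))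
    (fun l => turns (e k l) N (P i) (+) upper (Q l - P i))) => j l jl.
    rewrite eq_sym in jl.
    have := cell_turns N0 (fine _ _ _ _ ik jl); rewrite !e0 !e1.
    by do 4!case: (turns _ _ _); do 4!case: (upper _).
  by rewrite -upperN ?opprB // Qdis.
have := BB ord0 (lift ord0 ord0) isT; have := BB ord0 ord_max isT.
by have := BB (lift ord0 ord0) ord_max isT; do 3!case: (B _).
Qed.

End CompleteBipartite.

(** * Joining points of the plane inside a set *)

Section Joining.
Variable R : realType.
Notation plane := (R * R)%type.
Implicit Types (p q w : plane) (S A : set plane).

(** Paths need not be injective. The map is continuous on the whole line, so that paths compose
    without a subspace topology. *)
Definition joined S p q := exists f : R -> plane,
  [/\ continuous f, f 0 = p, f 1 = q & forall t, t \in `[0, 1] -> S (f t)].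

(** Only edges without a common end need disjoint sets; paths that share an end may overlap. *)
Lemma K33_nonplanar (P Q : 'I_3 -> plane) (S : 'I_3 -> 'I_3 -> set plane) :
  (forall i j, joined (S i j) (P i) (Q j)) ->
  ~ (forall i k j l, i != k -> j != l -> S i j `&` S k l `<=` set0).
Proof.
move=> SPQ dis.
have /choice[e He] (ij : 'I_3 * 'I_3) := SPQ ij.1 ij.2.
apply: (@K33_curves_meet R (fun i j => e (i, j)) P Q).
- by move=> i j; case: (He (i, j)).
- by move=> i j; case: (He (i, j)).
- by move=> i j; case: (He (i, j)).
move=> i k j l s t ik jl sI tI; apply/eqP => est.
apply: (dis _ _ _ _ ik jl (e (i, j) s)); split.
  by case: (He (i, j)) => _ _ _; apply.
by rewrite est; case: (He (k, l)) => _ _ _; apply.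
Qed.

(** * Reparametrised paths and arcs *)

Definition clamp (t : R) : R := Num.max 0 (Num.min 1 t).

Lemma clamp_itv t : clamp t \in `[0, 1].
Proof. by rewrite in_itv /= /clamp le_max lexx /= ge_max ler01 ge_min lexx. Qed.

Lemma clamp_id t : t \in `[0, 1] -> clamp t = t.
Proof.
by rewrite in_itv /= => /andP[t0 t1]; rewrite /clamp min_r // max_r.
Qed.

Lemma clamp_continuous : continuous clamp.
Proof.
by move=> t; apply: continuous_max; [exact: cst_continuous|
  apply: continuous_min; [exact: cst_continuous|exact: id]].
Qed.

Lemma joined_sub S S' p q : S `<=` S' -> joined S p q -> joined S' p q.
Proof. by move=> SS [f [cf f0 f1 fS]]; exists f; split=> // t /fS /SS. Qed.

Lemma joined_sym S p q : joined S p q -> joined S q p.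
Proof.
case=> f [cf f0 f1 fS]; exists (fun t => f (1 - t)); split.
- move=> t; apply: (@continuous_comp _ _ _ (fun t : R => 1 - t) f); last exact: cf.
  by apply: cvgB; [exact: cvg_cst|exact: cvg_id].
- by rewrite subr0.
- by rewrite subrr.
move=> t; rewrite in_itv /= => /andP[t0 t1]; apply: fS.
by rewrite in_itv /= subr_ge0 t1 gerBl.
Qed.

Lemma joined_trans S p q w : joined S p q -> joined S q w -> joined S p w.
Proof.
case=> f [cf f0 f1 fS] [g [cg g0 g1 gS]].
(* On each half of the interval one of the two clamped terms is constantly [q], so the paths are
   glued without a case distinction in the continuity proof. *)
exists (fun t => f (clamp (2 * t)) + g (clamp (2 * t - 1)) - q).
have cl0 (t : R) : t <= 0 -> clamp t = 0.
  by move=> t0; rewrite /clamp max_l // ge_min t0 orbT.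
have cl1 (t : R) : 1 <= t -> clamp t = 1.
  by move=> t1; rewrite /clamp min_l // max_r.
split.
- move=> t; apply: cvgB; last exact: cvg_cst.
  apply: cvgD.
    apply: (@continuous_comp _ _ _ (fun t : R => clamp (2 * t)) f); last exact: cf.
    apply: (@continuous_comp _ _ _ (fun t : R => 2 * t) clamp).
      by apply: cvgM; [exact: cvg_cst|exact: cvg_id].
    exact: clamp_continuous.
  apply: (@continuous_comp _ _ _ (fun t : R => clamp (2 * t - 1)) g); last exact: cg.
  apply: (@continuous_comp _ _ _ (fun t : R => 2 * t - 1) clamp).
    by apply: cvgB; [apply: cvgM; [exact: cvg_cst|exact: cvg_id]|exact: cvg_cst].
  exact: clamp_continuous.
- by rewrite !cl0 ?f0 ?g0 ?addrK //; lra.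
- by rewrite !cl1 ?f1 ?g1 1?addrC ?addKr //; lra.
move=> t tI; have [t2|t2] := leP (2 * t) 1.
  by rewrite (cl0 (2 * t - 1)) ?g0 ?addrK; [exact: fS (clamp_itv _)|lra].
by rewrite (cl1 (2 * t)) ?f1 1?addrC ?addKr; [exact: gS (clamp_itv _)|lra].
Qed.

Lemma line_continuous p q : continuous (fun t : R => p + t *: (q - p)).
Proof.
by move=> t; apply: cvgD; [exact: cvg_cst|apply: cvgZr_tmp; exact: cvg_id].
Qed.

Lemma joined_segment S p q :
  (forall t, t \in `[0, 1] -> S (p + t *: (q - p))) -> joined S p q.
Proof.
move=> pqS; exists (fun t => p + t *: (q - p)); split=> //.
- exact: line_continuous.
- by rewrite scale0r addr0.
- by rewrite scale1r addrC subrK.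
Qed.

Lemma within_clamp_continuous (f : R -> plane) :
  {within `[0, 1], continuous f} -> continuous (f \o clamp).
Proof.
move=> /subspace_continuousP cf t.
apply: cvg_comp (cf _ (clamp_itv t)) => U HU.
have {}HU : nbhs (clamp t) [set s | s \in `[0, 1] -> U s] by exact: HU.
have : nbhs t (clamp @^-1` [set s | s \in `[0, 1] -> U s]).
  exact: clamp_continuous HU.
by apply: filterS => s; apply; exact: clamp_itv.
Qed.

Lemma is_arc_sym A p q : is_arc A p q -> is_arc A q p.
Proof.
have rI (t : R) : t \in `[0, 1] -> 1 - t \in `[0, 1].
  by rewrite !in_itv /= => /andP[? ?]; apply/andP; split; lra.
case=> f [cf fI f0 f1 ->]; exists (fun t => f (clamp (1 - t))); split.
- apply: continuous_subspaceT => t.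
  apply: (@continuous_comp _ _ _ (fun t : R => 1 - t) (f \o clamp)).
    by apply: cvgB; [exact: cvg_cst|exact: cvg_id].
  exact: within_clamp_continuous.
- move=> s t sI tI /=; rewrite !clamp_id ?rI // => /fI.
  by rewrite !rI // => /(_ isT isT); lra.
- by rewrite subr0 clamp_id // in_itv /= ler01 lexx.
- by rewrite subrr clamp_id // in_itv /= ler01 lexx.
apply/seteqP; split=> w [t tI <-]; exists (1 - t); rewrite /= ?clamp_id ?rI //.
by rewrite opprB addrC subrK.
Qed.

(** The piece of the arc from [p] to [w] works: by injectivity the arc reaches [q] only at parameter
    1. *)
Lemma arc_joined A p q w : is_arc A p q -> A w -> w != q ->
  joined (A `\ q) p w.
Proof.
case=> f [cf fI f0 f1 ->] [t tI <-] wq.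
have /andP[t0 t1] : 0 <= t <= 1 by move: tI; rewrite /= in_itv.
have stI (s : R) : s \in `[0, 1] -> s * t \in `[0, 1].
  rewrite !in_itv /= => /andP[s0 s1]; rewrite mulr_ge0 //=.
  by rewrite -[leRHS]mulr1 ler_pM.
exists (fun s => f (clamp (s * t))); split.
- move=> s; apply: (@continuous_comp _ _ _ (fun s : R => s * t) (f \o clamp)).
    by apply: cvgM; [exact: cvg_id|exact: cvg_cst].
  exact: within_clamp_continuous.
- by rewrite mul0r clamp_id // in_itv /= ler01 lexx.
- by rewrite mul1r clamp_id.
move=> s sI; rewrite clamp_id ?stI //; split; first by exists (s * t) => //; exact: stI.
move=> /= fst1; have : s * t = 1.
  by apply: fI; rewrite ?stI ?f1 // in_itv /= ler01 lexx.
move: sI; rewrite in_itv /= => /andP[s0 s1] st1.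
suff t11 : t = 1 by move: wq; rewrite t11 f1 eqxx.
apply/eqP; rewrite eq_le t1 /= -st1 -[leRHS]mul1r ler_wpM2r //.
Qed.

Lemma arc_ends A p q : is_arc A p q -> A p /\ A q.
Proof.
case=> f [_ _ <- <- ->].
by split; [exists 0|exists 1]; rewrite //= in_itv /= ler01 lexx.
Qed.

Lemma arc_joined_ends A p q : is_arc A p q -> joined A p q.
Proof.
case=> f [cf fI f0 f1 ->]; exists (f \o clamp); split.
- exact: within_clamp_continuous.
- by rewrite /= clamp_id // in_itv /= ler01 lexx.
- by rewrite /= clamp_id // in_itv /= ler01 lexx.
by move=> t tI; exists (clamp t) => //; exact: clamp_itv.
Qed.

Lemma arc_closed A p q : is_arc A p q -> closed A.
Proof.
case=> f [cf fI f0 f1 ->]; apply: compact_closed; first exact: norm_hausdorff.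
by apply: continuous_compact => //; exact: segment_compact.
Qed.

(** * Access to the points of a face *)

Lemma ball_segment p q (e t : R) : ball p e q -> t \in `[0, 1] ->
  ball p e (q + t *: (p - q)).
Proof.
rewrite -ball_normE /= => pq; rewrite in_itv /= => /andP[t0 t1].
rewrite opprD addrA -{1}[p - q]scale1r -scalerBl normrZ.
rewrite (le_lt_trans _ pq) // -[leRHS]mul1r ler_wpM2r // ger0_norm ?subr_ge0 //.
by rewrite gerBl.
Qed.

(** Balls inside [S] are reached by segments, so the points of [S] joined to [p] and the other
    points of [S] both form open sets; the connected [F] lies in the first. *)
Lemma joined_connected S F p q : open S -> connected F -> F `<=` S ->
  F p -> F q -> joined S p q.
Proof.
move=> oS cF FS Fp Fq.
have reach w : S w -> exists2 e : R, 0 < e &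
    forall w', ball w e w' -> joined S w' w.
  move=> Sw; have /nbhs_ballP[e /= e0 we] : nbhs w S by exact: open_nbhs_nbhs.
  exists e => // w' ww; apply: joined_segment => t tI; apply: we.
  exact: ball_segment.
have oJ : open [set w | S w /\ joined S p w].
  rewrite openE => w [Sw pw]; have [e e0 He] := reach w Sw.
  have /nbhs_ballP[e' /= e'0 we] : nbhs w S by exact: open_nbhs_nbhs.
  apply/nbhs_ballP; exists (Num.min e e'); rewrite /= ?lt_min ?e0 // => w' ww.
  split; first by apply: we; apply: le_ball ww; rewrite ge_min lexx orbT.
  apply: joined_trans pw _; apply/joined_sym/He.
  by apply: le_ball ww; rewrite ge_min lexx.
have oN : open [set w | S w /\ ~ joined S p w].
  rewrite openE => w [Sw pw]; have [e e0 He] := reach w Sw.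
  have /nbhs_ballP[e' /= e'0 we] : nbhs w S by exact: open_nbhs_nbhs.
  apply/nbhs_ballP; exists (Num.min e e'); rewrite /= ?lt_min ?e0 // => w' ww.
  split; first by apply: we; apply: le_ball ww; rewrite ge_min lexx orbT.
  move=> pw'; apply: pw; apply: joined_trans pw' _; apply: He.
  by apply: le_ball ww; rewrite ge_min lexx.
have : F `&` [set w | S w /\ joined S p w] = F.
  apply: cF.
  - exists p; split=> //; split; first exact: FS.
    by apply: joined_segment => t _; rewrite subrr scaler0 addr0; exact: FS.
  - by exists [set w | S w /\ joined S p w].
  exists (~` [set w | S w /\ ~ joined S p w]); first exact: open_closedC.
  apply/seteqP; split=> w [Fw]; first by move=> [Sw pw]; split=> // -[].
  move=> nw; split=> //; split; first exact: FS.
  by apply: contrapT => npw; apply: nw; split=> //; exact: FS.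
by move=> e; move: Fq; rewrite -e => -[_ []].
Qed.

Lemma first_hit A p q : closed A -> A q -> exists2 t : R, t \in `[0, 1] &
  A (p + t *: (q - p)) /\
  forall s : R, s \in `[0, 1] -> s < t -> ~ A (p + s *: (q - p)).
Proof.
move=> cA Aq; pose L (t : R) := p + t *: (q - p).
have cK : compact (`[0, 1] `&` L @^-1` A).
  apply: compact_closedI; first exact: segment_compact.
  apply: closed_comp => // t _; exact: line_continuous.
have K1 : (`[0, 1] `&` L @^-1` A) !=set0.
  exists 1; split; first by rewrite /= in_itv /= ler01 lexx.
  by rewrite /= /L scale1r addrC subrK.
have [t /set_mem[tI At] tmin] := @compact_EVT_min _ R id _ K1 cK
  (continuous_subspaceT (fun t => cvg_id)).
exists t => //; split=> // s sI st As.
by have := tmin s (mem_set (conj sI As)); rewrite leNgt st.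
Qed.

(** A point [z] of [F] is a third centre beside [x] and [y]; a point [w i] on each side, reachable
    from [z], completes a [K_{3,3}]. *)
Lemma theta_face (x y : plane) (A : 'I_3 -> set plane) (v : 'I_3 -> plane)
    (F : set plane) :
  (forall i, closed (A i)) ->
  (forall i j, i != j -> A i `&` A j `<=` [set x; y]) ->
  (forall i w, A i w -> w != x -> w != y ->
    joined (A i `\ y) x w /\ joined (A i `\ x) y w) ->
  connected F -> F `<=` ~` (\bigcup_i A i) ->
  (forall i, [/\ A i (v i), v i != x & v i != y]) ->
  ~ (forall i, closure F (v i)).
Proof.
move=> cA AA Aj cF FA vA vF.
have cU (D : set 'I_3) : closed (\bigcup_(i in D) A i).
  by apply: closed_bigcup => //; exact: finite_finset.
have [z [Fz _]] := vF ord0 setT filterT.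
have /choice[w Hw] : forall i, exists w, [/\ A i w, w != x, w != y &
    joined (~` (\bigcup_i A i) `|` [set w]) z w].
  move=> i; have [Av vx vy] := vA i.
  (* A ball around [v i] that avoids [C] contains a point [p] of [F]. The segment from [p] to [v i]
     meets no other side, and its first point on [A i] serves as [w i]. *)
  pose C := \bigcup_(j in [set j | j != i]) A j `|` [set x; y].
  have /closed_openC oC : closed C.
    by apply: closedU => //; apply: closedU;
      apply: accessible_closed_set1; apply: hausdorff_accessible; exact: norm_hausdorff.
  have /nbhs_ballP[e /= e0 eC] : nbhs (v i) (~` C).
    apply: open_nbhs_nbhs; split=> // -[[j /= ji Aj']|[]]; last 2 first.
    - by move/eqP; apply/negP.
    - by move/eqP; apply/negP.
    by have [] := AA _ _ ji (v i) (conj Aj' Av) => /eqP; apply/negP.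
  have [p [Fp vp]] := vF i _ (nbhsx_ballx (v i) e e0).
  have [t tI [At tmin]] := first_hit p (cA i) Av.
  have inb (s : R) : s \in `[0, 1] -> ball (v i) e (p + s *: (v i - p)).
    by move=> sI; exact: ball_segment.
  set w := p + t *: (v i - p) in At *.
  have wC : ~ C w by apply: eC; exact: inb.
  have wx : w != x by apply/eqP => wx; apply: wC; right; left.
  have wy : w != y by apply/eqP => wy; apply: wC; right; right.
  exists w; split=> //; apply: (@joined_trans _ _ p).
    apply: joined_sub (joined_connected _ cF FA Fz Fp); first by left.
    exact: closed_openC.
  apply: joined_segment => s sI; move: tI sI; rewrite !in_itv /=.
  move=> /andP[t0 t1] /andP[s0 s1].
  have -> : p + s *: (w - p) = p + (s * t) *: (v i - p).
    by rewrite /w [p + _ - p]addrC addKr scalerA.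
  have [->|s1'] := eqVneq s 1; first by rewrite mul1r; right.
  have [t00|t00] := eqVneq t 0; first by rewrite t00 mulr0 -t00; right.
  have st : s * t < t.
    by rewrite gtr_pMl ?lt_neqAle ?s1' // eq_sym t00.
  have stI : s * t \in `[0, 1].
    by rewrite in_itv /= mulr_ge0 //= ltW // (lt_le_trans st).
  left=> -[j _ Aj']; have [ji|ji] := eqVneq j i.
    by case: (tmin _ stI st); move: Aj'; rewrite ji.
  by case: (eC _ (inb _ stI)); left; exists j.
(* The default values of [nth] serve index 2: the centre [z], whose paths run off all sides up to
   their end [w j]. *)
pose P (i : 'I_3) := nth z [:: x; y] i.
pose S (i j : 'I_3) := nth (~` (\bigcup_i A i) `|` [set w j])
  [:: A j `\ y; A j `\ x] i.
apply: (@K33_nonplanar P w S).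
  move=> i j; have [Aw wx wy zw] := Hw j; have [xw yw] := Aj _ _ Aw wx wy.
  by case: i => [[|[|[|//]]] ?].
have AwF j l : j != l -> ~ A j (w l).
  move=> jl Ajw; have [Aw wx wy _] := Hw l.
  by have [] := AA _ _ jl _ (conj Ajw Aw) => /eqP; apply/negP.
have AxAy j l : j != l -> (A j `\ y) `&` (A l `\ x) `<=` set0.
  by move=> jl u [[Aj' uy] [Al ux]]; have [] := AA _ _ jl _ (conj Aj' Al).
have AF (B : set plane) j l : j != l -> B `<=` A j ->
    B `&` (~` (\bigcup_i A i) `|` [set w l]) `<=` set0.
  move=> jl BA u [/BA Aj' [nu|/= uw]]; first by apply: nu; exists j.
  by apply: (AwF _ _ jl); rewrite -uw.
have sx (B : set plane) a : B `\ a `<=` B by move=> u [].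
move=> i k j l ik jl; have lj : l != j by rewrite eq_sym.
move: ik; case: i => [[|[|[|//]]] ?]; case: k => [[|[|[|//]]] ?] //= _.
- exact: AxAy.
- exact: (AF _ _ _ jl (@sx _ _)).
- by rewrite setIC; exact: AxAy.
- exact: (AF _ _ _ jl (@sx _ _)).
- by rewrite setIC; exact: (AF _ _ _ lj (@sx _ _)).
- by rewrite setIC; exact: (AF _ _ _ lj (@sx _ _)).
Qed.

End Joining.

(** * No [K_{2,3}] minor in an outerplanar graph *)

Section Sides.
Variables (R : realType) (V : finType) (G : sgraph V).
Notation plane := (R * R)%type.
Variables (pt : V -> plane) (curve : {set V} -> set plane).
Hypothesis drawing : plane_drawing G pt curve.

Let pt_inj : injective pt. Proof. by case: drawing. Qed.

Lemma edge_mem u v : adj G u v -> [set u; v]%SET \in edges G.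
Proof. by move=> uv; apply/imsetP; exists (u, v); rewrite ?inE. Qed.

Lemma edge_arc u v : adj G u v -> is_arc (curve [set u; v]%SET) (pt u) (pt v).
Proof. by case: drawing => _ + _ _; apply. Qed.

(** Any other vertex on the curve would lie in the interior of the arc, which avoids all
    vertices. *)
Lemma curve_vertex u v z : adj G u v -> curve [set u; v]%SET (pt z) ->
  z = u \/ z = v.
Proof.
move=> uv cz; case: drawing => _ _ /(_ _ (edge_mem uv)) int0 _.
apply: contrapT => zuv; suff : set0 (pt z) by [].
rewrite -int0; split; last by exists z.
split=> // -[z' /= + /pt_inj zz']; rewrite zz' !inE => /orP[] /eqP ?; apply: zuv; auto.
Qed.

Lemma curve_meet u v u' v' w : adj G u v -> adj G u' v' ->
  [set u; v]%SET != [set u'; v']%SET ->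
  curve [set u; v]%SET w -> curve [set u'; v']%SET w ->
  exists2 z, w = pt z & (z = u \/ z = v) /\ (z = u' \/ z = v').
Proof.
move=> uv uv' neq cw cw'; case: drawing => _ _ _ disj.
have [z zE zw] : (pt @` [set z | z \in [set u; v]%SET]) w.
  apply: contrapT => nw; suff : set0 w by [].
  by rewrite -(disj _ _ (edge_mem uv) (edge_mem uv') neq).
exists z => //; split; first by move: zE => /=; rewrite !inE => /orP[] /eqP; auto.
by apply: (curve_vertex uv'); rewrite zw.
Qed.

Variables (x y : V).

(* The drawing of the edges that meet [O] and have both ends in
   [O] together with [x] and [y]. *)
Definition side (O : {set V}) : set plane :=
  \bigcup_(p in [set p : V * V | [&& p.1 \in O, p.2 \in x |: (y |: O) & adj G p.1 p.2]%SET])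
    curve [set p.1; p.2]%SET.

Lemma sideP (O : {set V}) w : side O w -> exists u v,
  [/\ u \in O, v \in (x |: (y |: O))%SET, adj G u v & curve [set u; v]%SET w].
Proof. by case=> -[u v] /= /and3P[]; exists u, v. Qed.

Lemma side_closed O : closed (side O).
Proof.
apply: closed_bigcup; first exact: finite_finset.
by move=> [u v] /= /and3P[_ _ uv]; exact: arc_closed (edge_arc uv).
Qed.

Lemma curve_side (O : {set V}) u v : u \in O -> v \in (x |: (y |: O))%SET ->
  adj G u v -> curve [set u; v]%SET `<=` side O.
Proof. by move=> uO vO uv w cw; exists (u, v) => //=; rewrite uO vO uv. Qed.

Lemma side_vertex (O : {set V}) u z : u \in O -> adj G z u ->
  z \in (x |: (y |: O))%SET -> side O (pt u).
Proof.
move=> uO zu zO; rewrite adj_sym in zu; apply: (curve_side uO zO zu).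
by have [] := arc_ends (edge_arc zu).
Qed.

(** * Paths within one side *)

Section BranchSet.
Variable O : {set V}.
Hypotheses (xO : x \notin O) (yO : y \notin O).

Let inner := side O `\` [set pt x; pt y].

Lemma inner_curve u v : u \in O -> v \in O -> adj G u v ->
  curve [set u; v]%SET `<=` inner.
Proof.
move=> uO vO uv w cw; split; first by apply: (curve_side uO _ uv cw); rewrite !inE vO !orbT.
case=> /= ew; rewrite ew in cw.
  by have [xu|xv] := curve_vertex uv cw; move: xO; rewrite ?xu ?xv ?uO ?vO.
by have [yu|yv] := curve_vertex uv cw; move: yO; rewrite ?yu ?yv ?uO ?vO.
Qed.

Lemma inner_vertex_joined u v : connect (induced_rel G O) u v ->
  inner (pt u) -> joined inner (pt u) (pt v).
Proof.
case/connectP=> p + ->; elim: p u => [|z p IH] u /=.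
  by move=> _ iu; apply: joined_segment => t _; rewrite subrr scaler0 addr0.
case/andP=> /and3P[uO zO uz] zp iu.
have uz_in := inner_curve uO zO uz.
apply: joined_trans (IH z zp _); last first.
  by apply: uz_in; have [] := arc_ends (edge_arc uz).
exact: joined_sub uz_in (arc_joined_ends (edge_arc uz)).
Qed.

(** The point [w] lies on an edge from some [u] in [O]. A walk inside [O] reaches [u], and the arc
    from [u] to [w] stops before its far end, the only place where it could meet [x] or [y]. If [w]
    is the far end, that end is in [O]. *)
Lemma inner_joined o w : induces_connected G O -> o \in O -> inner (pt o) ->
  side O w -> w != pt x -> w != pt y -> joined inner (pt o) w.
Proof.
case/andP=> _ /forall_inP conn oO io /sideP[u [v [uO vO uv cw]]] wx wy.
have con z : z \in O -> joined inner (pt o) (pt z).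
  by move=> zO; apply: inner_vertex_joined => //; have /forall_inP := conn _ oO; apply.
have [ew|wv] := eqVneq w (pt v).
  rewrite ew; apply: con; move: vO; rewrite !inE => /or3P[/eqP vx|/eqP vy|//].
    by rewrite ew vx eqxx in wx.
  by rewrite ew vy eqxx in wy.
apply: joined_trans (con _ uO) _.
apply: joined_sub (arc_joined (edge_arc uv) cw wv) => z [cz zv].
split; first exact: (curve_side uO vO uv).
case=> /= ez; rewrite ez in cz zv.
  have [xu|xv] := curve_vertex uv cz; first by rewrite -xu (negPf xO) in uO.
  by apply: zv; rewrite xv.
have [yu|yv] := curve_vertex uv cz; first by rewrite -yu (negPf yO) in uO.
by apply: zv; rewrite yv.
Qed.

(** The edge from [a] to [o] leads into the inner part of the side, which contains neither [pt x]
    nor [pt y]. The first hypothesis treats both orders of [x] and [y] at once. *)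
Lemma side_joined_end a b o w : (a = x /\ b = y) \/ (a = y /\ b = x) ->
  a != b -> induces_connected G O -> o \in O -> adj G a o ->
  side O w -> w != pt x -> w != pt y -> joined (side O `\ pt b) (pt a) w.
Proof.
move=> abxy ab conn oO ao Ow wx wy.
have aS : a \in (x |: (y |: O))%SET.
  by rewrite !inE; case: abxy => -[-> _]; rewrite eqxx ?orbT.
have bO : b \notin O by case: abxy => -[_ ->].
have so := side_vertex oO ao aS.
have io : inner (pt o).
  by split=> // -[] /pt_inj eo; [move: xO|move: yO]; rewrite -eo oO.
have ib : inner `<=` side O `\ pt b.
  by move=> z [sz zxy]; split=> // zb; apply: zxy; case: abxy => -[_ eb];
    rewrite eb in zb; [right|left].
apply: joined_trans (joined_sub ib (inner_joined conn oO io Ow wx wy)).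
apply: joined_sub (joined_sym (arc_joined_ends (edge_arc (_ : adj G o a)))).
  have oa : adj G o a by rewrite adj_sym.
  move=> z cz; split; first exact: (curve_side oO aS oa).
  move=> /= zb; rewrite zb in cz; have [bo|ba] := curve_vertex oa cz.
    by rewrite bo oO in bO.
  by rewrite ba eqxx in ab.
by rewrite adj_sym.
Qed.

End BranchSet.

(** Every edge of the first side has an end in [O], which no edge of the second side has. The curves
    therefore belong to distinct edges and meet only in common ends, which lie outside [O]. *)
Lemma sides_meet (O O' : {set V}) :
  x \notin O -> y \notin O -> {in O, forall z, z \notin O'} ->
  side O `&` side O' `<=` [set pt x; pt y].
Proof.
move=> xO yO OO' w [/sideP[u [v [uO vO uv cw]]] /sideP[u' [v' [uO' vO' uv' cw']]]].
have nO z : z \in O -> z \notin (x |: (y |: O'))%SET.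
  move=> zO; rewrite !inE !negb_or (OO' _ zO) andbT.
  by apply/andP; split; [apply: contraNneq xO|apply: contraNneq yO] => <-.
have nO' z : z \in O' -> z \notin O by apply: contraL => /OO'.
have neq : [set u; v]%SET != [set u'; v']%SET.
  apply/eqP => /finset.setP /(_ u); rewrite !inE eqxx /= => /esym/orP[] /eqP eu.
    by move: (nO' _ uO'); rewrite -eu uO.
  by move: (nO _ uO); rewrite eu vO'.
have [z -> [zuv zuv']] := curve_meet uv uv' neq cw cw'.
have zO' : z \in (x |: (y |: O'))%SET.
  by case: zuv' => -> //; rewrite !inE uO' !orbT.
have : z \in (x |: (y |: O))%SET by case: zuv => -> //; rewrite !inE uO !orbT.
rewrite !inE => /or3P[/eqP ->|/eqP ->|zO]; [by left|by right|].
by move: (nO _ zO); rewrite zO'.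
Qed.

End Sides.

(** Some face has all vertices on its boundary; a neighbour of [x] in each branch set is then a
    point of each side in the closure of that face, against [theta_face]. *)
Theorem outerplanar_no_K23 (R : realType) (V : finType) (G : sgraph V) (x y : V)
    (O : 'I_3 -> {set V}) :
  outerplanar R G -> x != y ->
  (forall i, x \notin O i /\ y \notin O i) ->
  (forall i j, i != j -> {in O i, forall z, z \notin O j}) ->
  (forall i, induces_connected G (O i)) ->
  (forall i, exists2 o, o \in O i & adj G x o) ->
  ~ (forall i, exists2 o, o \in O i & adj G y o).
Proof.
case=> pt [curve [dr [F [[p Fp ->] _ bd]]]] xy xyO OO conn xo yo.
have pt_inj : injective pt by case: dr.
have /choice[rep Hrep] : forall i, exists o, o \in O i /\ adj G x o.
  by move=> i; case: (xo i) => o; exists o.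
apply: (@theta_face R (pt x) (pt y) (fun i => side G curve x y (O i))
  (fun i => pt (rep i)) (connected_component (~` drawn_set G pt curve) p)).
- by move=> i; exact: (side_closed dr).
- by move=> i j ij; have [xi yi] := xyO i; exact: (sides_meet dr xi yi (OO _ _ ij)).
- move=> i w Ow wx wy; have [xi yi] := xyO i; split.
    have [oi oiO xoi] := xo i.
    by apply: (side_joined_end dr xi yi _ xy (conn i) oiO xoi Ow wx wy); left.
  have [oi oiO yoi] := yo i; rewrite eq_sym in xy.
  by apply: (side_joined_end dr xi yi _ xy (conn i) oiO yoi Ow wx wy); right.
- exact: component_connected.
- move=> w Fw [i _ /sideP[u [v [uO vO uv cw]]]].
  have /(_ _ Fw) := @connected_component_sub _ (~` drawn_set G pt curve) p.
  by apply; right; exists [set u; v]%SET => //=; exact: edge_mem.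
- move=> i; have [oO xo'] := Hrep i; have [xi yi] := xyO i; split.
  + by apply: (side_vertex dr oO xo'); rewrite !inE eqxx.
  + by apply: contraNneq xi => /pt_inj <-.
  + by apply: contraNneq yi => /pt_inj <-.
by move=> i; case: (bd (rep i)).
Qed.

(** * Connected triples *)

Section Combinatorics.
Variable V : finType.
Implicit Types (G H : sgraph V) (S : {set V}) (a b c u v w x y z : V).

Lemma exists_fresh (s : seq V) : (size s < #|V|)%N -> exists w, w \notin s.
Proof.
move=> sV; apply/existsP; apply: contraLR sV => /existsPn all_s.
rewrite -leqNgt (leq_trans _ (card_size s)) //.
by apply/subset_leq_card/fintype.subsetP => w _; rewrite -[_ \in _]negbK all_s.
Qed.

Lemma connect_exit (e : rel V) S u w : connect e u w -> u \in S -> w \notin S ->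
  exists s t, [/\ e s t, s \in S & t \notin S].
Proof.
case/connectP=> p + ->; elim: p u => [|z p IH] u /=; first by move=> _ ->.
case/andP=> uz zp uS wS; have [zS|zS] := boolP (z \in S); first exact: IH zp zS wS.
by exists u, z.
Qed.

(** After [z] is removed, a path from [u] to [w] must still leave [S]: no single vertex cuts [S] off
    from the rest. *)
Lemma two_connected_exit G S z u w : k_connected G 2 -> u \in S -> z \notin S ->
  w \notin S -> w != z ->
  exists s t, [/\ adj G s t, s \in S, t \notin S & t != z].
Proof.
case=> _ /(_ [set z]%SET); rewrite cards1 => /(_ isT) /andP[_ /forall_inP conn].
move=> uS zS wS wz; have uz : u != z by apply: contraNneq zS => <-.
have /conn/forall_inP/(_ w) : u \in (~: [set z])%SET by rewrite !inE.
rewrite !inE => /(_ wz) /connect_exit /(_ uS wS)[s [t [/and3P[_ + st] sS tS]]].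
by rewrite !inE => tz; exists s, t.
Qed.

(** Each of the three vertices needs a neighbour in the triple, which takes two edges. The
    right-hand side is the majority of the three adjacencies. *)
Lemma triple_connected G a b c : a != b -> a != c -> b != c ->
  ([set a; b; c]%SET \in connected_triples G) =
  [|| adj G a b && adj G a c, adj G a b && adj G b c | adj G a c && adj G b c].
Proof.
move=> ab ac bc; set S := [set a; b; c]%SET.
have S3 : #|S| == 3 by rewrite /S -finset.setUA !cardsU1 cards1 !inE negb_or ab ac bc.
have [aS bS cS] : [/\ a \in S, b \in S & c \in S] by rewrite !inE !eqxx !orbT.
rewrite inE S3 /=; apply/idP/idP => [/andP[_ /forall_inP conn]|edges2].
  have nb z w : z \in S -> w \in S -> z != w ->
      exists2 t, t \in S & (t != z) && adj G z t.
    move=> zS wS zw; have /forall_inP/(_ w wS) := conn z zS.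
    have wz : w \notin [set z]%SET by rewrite !inE eq_sym.
    case/connect_exit/(_ (set11 z) wz) => s [t [/and3P[_ tS st] + +]].
    by rewrite !inE => /eqP <- tz; exists t; rewrite // tz.
  have [t tS /andP[ta at_]] := nb a b aS bS ab.
  have [t' tS' /andP[tb bt]] := nb b c bS cS bc.
  rewrite eq_sym in ac; have [t'' tS'' /andP[tc ct]] := nb c a cS aS ac.
  move: ta at_ tb bt tc ct; move: tS tS' tS''; rewrite !inE -!orbA.
  do 3!case/or3P=> /eqP ->; rewrite ?eqxx //= => _ + _ + _;
    rewrite ?[adj G b a]adj_sym ?[adj G c a]adj_sym ?[adj G c b]adj_sym;
    by case: (adj G a b); case: (adj G a c); case: (adj G b c).
have e_sym : connect_sym (induced_rel G S).
  by apply: sym_connect_sym => u v; rewrite /induced_rel /= adj_sym andbCA.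
have cadj u v : u \in S -> v \in S -> adj G u v -> connect (induced_rel G S) u v.
  by move=> uS vS uv; apply: connect1; rewrite /induced_rel /= uS vS.
suff ca z : z \in S -> connect (induced_rel G S) a z.
  apply/andP; split; first by apply/finset.set0Pn; exists a.
  apply/forall_inP => u uS; apply/forall_inP => v vS.
  by apply: (connect_trans _ (ca v vS)); rewrite e_sym; exact: ca.
rewrite !inE -orbA => /or3P[] /eqP ->; first exact: connect0.
- case/or3P: edges2 => /andP[e1 e2]; [exact: cadj|exact: cadj|].
  by apply: (connect_trans (cadj _ _ aS cS e1)); rewrite e_sym; exact: cadj.
- case/or3P: edges2 => /andP[e1 e2]; [exact: cadj| |exact: cadj].
  by apply: (connect_trans (cadj _ _ aS bS e1)); exact: cadj.
Qed.

(** All vertices of a path from [u] inside [S] are themselves reached from [u], so the path stays in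
    the component. *)
Lemma component_induces_connected G S u : u \in S ->
  induces_connected G [set z | connect (induced_rel G S) u z]%SET.
Proof.
move=> uS; set C := [set z | _]%SET.
have uC : u \in C by rewrite inE connect0.
have e_sym : connect_sym (induced_rel G C).
  by apply: sym_connect_sym => v w; rewrite /induced_rel /= adj_sym andbCA.
have cu z : z \in C -> connect (induced_rel G C) u z.
  rewrite inE => /connectP[p up ->]; apply/connectP; exists p => //.
  suff: forall v, v \in C -> path (induced_rel G S) v p ->
    path (induced_rel G C) v p by apply.
  elim: p {up} => [|w p IH] v //=; rewrite inE => uv /andP[vw wp].
  have uw : connect (induced_rel G S) u w := connect_trans uv (connect1 vw).
  have /and3P[_ _ gvw] := vw.
  by rewrite IH ?inE // andbT /induced_rel /= !inE uv uw.
apply/andP; split; first by apply/finset.set0Pn; exists u.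
apply/forall_inP => v vC; apply/forall_inP => w wC.
by apply: (connect_trans _ (cu w wC)); rewrite e_sym; exact: cu.
Qed.

Lemma set1_induces_connected G a : induces_connected G [set a]%SET.
Proof.
apply/andP; split; first by apply/finset.set0Pn; exists a; rewrite inE.
apply/forall_inP => u /set1P ->; apply/forall_inP => v /set1P ->.
exact: connect0.
Qed.

(** * Branch sets of [K_{2,3}] in an outerplanar graph *)

Variable R : realType.

Lemma K23_branch_sets G x y a b S :
  outerplanar R G -> uniq [:: x; y; a; b] ->
  x \notin S -> y \notin S -> a \notin S -> b \notin S ->
  induces_connected G S ->
  adj G x a -> adj G x b -> adj G y a -> adj G y b ->
  (exists2 s, s \in S & adj G x s) -> ~ (exists2 s, s \in S & adj G y s).
Proof.
move=> outG /= /and4P[]; rewrite !inE !negb_or.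
move=> /and3P[xy xa xb] /andP[ya yb] ab _ xS yS aS bS conn gxa gxb gya gyb xs ys.
pose O (i : 'I_3) := nth S [:: [set a]; [set b]]%SET i.
apply: (@outerplanar_no_K23 R V G x y O outG xy).
- by case=> [[|[|[|//]]] ?]; rewrite /O /= ?inE.
- case=> [[|[|[|//]]] ?]; case=> [[|[|[|//]]] ?] //= _; rewrite /O /= => z;
    rewrite ?inE.
  + by move/eqP ->; rewrite ab.
  + by move/eqP ->.
  + by move/eqP ->; rewrite eq_sym ab.
  + by move/eqP ->.
  + by apply: contraTneq => ->.
  + by apply: contraTneq => ->.
- case=> [[|[|[|//]]] ?]; rewrite /O //=; exact: set1_induces_connected.
- case=> [[|[|[|//]]] ?]; rewrite /O //=.
  + by exists a; rewrite ?inE.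
  + by exists b; rewrite ?inE.
case=> [[|[|[|//]]] ?]; rewrite /O //=.
+ by exists a; rewrite ?inE.
+ by exists b; rewrite ?inE.
Qed.

Lemma common_neighbours_le2 G x y a b c :
  outerplanar R G -> uniq [:: x; y; a; b; c] ->
  adj G x a -> adj G x b -> adj G x c ->
  adj G y a -> adj G y b -> ~ adj G y c.
Proof.
move=> outG; rewrite -[uniq _]/(uniq ([:: x; y; a; b] ++ [:: c])) cats1 rcons_uniq.
rewrite [c \in _]inE !inE !negb_or => /andP[/and4P[cx cy ca cb] un4].
move=> xa xb xc ya yb yc.
have nc z : c != z -> z \notin [set c]%SET by rewrite inE eq_sym.
apply: (@K23_branch_sets G x y a b [set c]%SET outG un4) => //; try exact: nc.
- exact: set1_induces_connected.
- by exists c; rewrite ?inE.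
- by exists c; rewrite ?inE.
Qed.

(** Edges leaving the component of [u] off the square end in [x] or [y]. Removing either of these
    forces an edge to the other, so the component is a third branch set beside [{a}] and [{b}]. *)
Lemma no_pendant_square G x y a b u :
  outerplanar R G -> k_connected G 2 -> uniq [:: x; y; a; b] ->
  u \notin [:: x; y; a; b] ->
  adj G x a -> adj G x b -> adj G y a -> adj G y b ->
  ~ (forall c, c \notin [:: x; y; a; b] -> ~~ adj G a c && ~~ adj G b c).
Proof.
move=> outG conn2 un4 u4 xa xb ya yb iso.
pose S := [set z | z \notin [:: x; y; a; b]]%SET.
pose C := [set z | connect (induced_rel G S) u z]%SET.
have uS : u \in S by rewrite inE.
have CS z : z \in C -> z \in S.
  rewrite inE => uz; have [//|zS] := boolP (z \in S).
  by have [s [t [/and3P[_ tS _] _ /negP]]] := connect_exit uz uS zS.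
have exit s t : s \in C -> t \notin C -> adj G s t -> t = x \/ t = y.
  move=> sC tC st; have [tS|] := boolP (t \in S).
    case/negP: tC; move: (sC); rewrite !inE => us.
    by apply: (connect_trans us); apply: connect1; rewrite /induced_rel /= tS st CS.
  have := CS _ sC; rewrite inE => /iso /andP[nas nbs].
  rewrite inE negbK !inE => /or4P[] /eqP tE; [by left|by right| |].
    by rewrite -tE adj_sym st in nas.
  by rewrite -tE adj_sym st in nbs.
have nC z : z \in [:: x; y; a; b] -> z \notin C.
  by move=> z4; apply: contraL z4 => /CS; rewrite inE.
have [xC yC] : x \notin C /\ y \notin C by split; apply: nC; rewrite !inE eqxx ?orbT.
have uC : u \in C by rewrite inE connect0.
have xy : x != y by move: un4; rewrite /= !inE; case: eqP.
apply: (@K23_branch_sets G x y a b C outG un4) => //.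
- by apply: nC; rewrite !inE eqxx ?orbT.
- by apply: nC; rewrite !inE eqxx ?orbT.
- exact: component_induces_connected.
- have [s [t [st sC tC ty]]] := two_connected_exit conn2 uC yC xC xy.
  have [tx|ty'] := exit _ _ sC tC st; last by rewrite ty' eqxx in ty.
  by exists s; rewrite // -tx adj_sym.
rewrite eq_sym in xy.
have [s [t [st sC tC tx]]] := two_connected_exit conn2 uC xC yC xy.
have [tx'|ty'] := exit _ _ sC tC st; first by rewrite tx' eqxx in tx.
by exists s; rewrite // -ty' adj_sym.
Qed.

(** * Two graphs with the same connected triples *)

Section Comparison.
Variables G H : sgraph V.
Hypotheses (V6 : (6 <= #|V|)%N) (G2 : k_connected G 2) (H2 : k_connected H 2).
Hypotheses (outG : outerplanar R G) (outH : outerplanar R H).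
Hypothesis GH : connected_triples G = connected_triples H.

Let maj_GH a b c : a != b -> a != c -> b != c ->
  [|| adj G a b && adj G a c, adj G a b && adj G b c | adj G a c && adj G b c] =
  [|| adj H a b && adj H a c, adj H a b && adj H b c | adj H a c && adj H b c].
Proof. by move=> ab ac bc; rewrite -!triple_connected // GH. Qed.

(** If [ay] is missing from [G], the triples [{a, y, u}] show that in [H] no vertex of [S] is
    adjacent to [a] or [y], so [S] is left only through [x] or [b]. Avoiding [x], some [s] in [S] is
    adjacent to [b]; the rest of [S] is then left only through [x], against 2-connectedness. *)
Lemma corner_adj a b x y :
  adj H a x -> adj H a y ->
  (forall c, c \notin [:: x; y; a; b] -> ~~ adj G a c && ~~ adj G b c) ->
  adj G a y.
Proof.
move=> ax ay iso; apply: contraTT isT => nay.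
pose S := [set z | z \notin [:: x; y; a; b]]%SET.
have xS : x \notin S by rewrite !inE eqxx.
have aS : a \notin S by rewrite !inE eqxx !orbT.
have ax' : a != x by apply: contraTneq ax => ->; rewrite adj_irrefl.
have ay' : a != y by apply: contraTneq ay => ->; rewrite adj_irrefl.
have Sne z w : z \in S -> w \in [:: x; y; a; b] -> w != z.
  by rewrite inE => zS; apply: contraTneq => ->.
have noa u : u \in S -> ~~ adj H u a /\ ~~ adj H u y.
  move=> uS; have ua := Sne u a uS; have uy := Sne u y uS.
  have := uS; rewrite inE => /iso /andP[nau _].
  have := @maj_GH a y u ay' (ua _) (uy _); rewrite !inE !eqxx !orbT => /(_ isT isT).
  rewrite (negPf nay) (negPf nau) ay /= ![adj H u _]adj_sym.
  by case: (adj H a u); case: (adj H y u).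
have [u u4] := @exists_fresh [:: x; y; a; b] (leq_trans (isT : 4 < 6)%N V6).
have uS : u \in S by rewrite inE.
have [s [t [st sS tS tx]]] := two_connected_exit H2 uS xS aS ax'.
have tb : t = b.
  move: tS tx; have [nsa nsy] := noa s sS.
  rewrite inE negbK !inE => /or4P[] /eqP tE; rewrite -?tE ?eqxx // in nsa nsy *.
    by rewrite st in nsy.
  by rewrite st in nsa.
rewrite tb in st.
(* The bound of six vertices gives a vertex of [S] besides [s]. *)
have [w w5] := @exists_fresh [:: s; x; y; a; b] V6.
have wS : w \in (S :\ s)%SET.
  by move: w5; rewrite [in X in X -> _]inE negb_or !inE => /andP[-> ->].
have xS' : x \notin (S :\ s)%SET by rewrite finset.in_setD1 (negPf xS) andbF.
have aS' : a \notin (S :\ s)%SET by rewrite finset.in_setD1 (negPf aS) andbF.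
have [s' [t' [st' + tS' tx']]] := two_connected_exit H2 wS xS' aS' ax'.
rewrite finset.in_setD1 => /andP[ss' sS'].
have b4 : b \in [:: x; y; a; b] by rewrite !inE eqxx !orbT.
(* [G] has neither [bs] nor [bs'], while [bs] is in [H]; hence [H] has neither [bs'] nor [ss']. *)
have := @maj_GH b s s' (Sne _ _ sS b4) (Sne _ _ sS' b4) _.
have := sS; rewrite inE => /iso /andP[_ nbs].
have := sS'; rewrite inE => /iso /andP[_ nbs'].
rewrite (negPf nbs) (negPf nbs') [adj H b s]adj_sym st /= eq_sym ss' => /(_ isT).
move/esym/negbT; rewrite !negb_or => /and3P[hbs hss _].
have [nsa nsy] := noa s' sS'.
move: tS' tx'; rewrite finset.in_setD1 negb_and negbK => /orP[/eqP tE|].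
  by rewrite adj_sym -tE st' in hss.
rewrite inE negbK !inE => /or4P[] /eqP tE; rewrite tE in st'.
- by rewrite tE eqxx.
- by rewrite st' in nsy.
- by rewrite st' in nsa.
- by rewrite adj_sym st' in hbs.
Qed.

Lemma adj_sub a b : adj G a b -> adj H a b.
Proof.
move=> gab; apply: contraTT isT => nhab.
have ab : a != b by apply: contraTneq gab => ->; rewrite adj_irrefl.
(* As [ab] is an edge of [G] only, the triple is connected in [G] when [c] is adjacent to one of
   [a], [b], and in [H] when it is adjacent to both. *)
have nbr c : c != a -> c != b -> (adj G a c || adj G b c) = adj H a c && adj H b c.
  move=> ca cb; have := @maj_GH a b c ab.
  rewrite ![_ == c]eq_sym => /(_ ca cb).
  by rewrite gab (negPf nhab) /= => <-; case: (adj G a c); case: (adj G b c).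
pose S := [set a; b]%SET.
have aS : a \in S by rewrite !inE eqxx.
(* By 2-connectedness [{a, b}] has an outside neighbour in [G] other than any given [z]; two uses
   give distinct [x] and [y]. *)
have pick z : z \notin S -> exists x, [/\ x \notin S, x != z & adj G a x || adj G b x].
  move=> zS; have [w] := @exists_fresh [:: a; b; z] (leq_trans (isT : 3 < 6)%N V6).
  rewrite !inE !negb_or => /and3P[wa wb wz].
  have wS : w \notin S by rewrite !inE negb_or wa.
  have [s [t [st sS tS tz]]] := two_connected_exit G2 aS zS wS wz.
  exists t; split=> //; move: sS; rewrite !inE => /orP[] /eqP <-; rewrite st ?orbT //.
have [z0] := @exists_fresh [:: a; b] (leq_trans (isT : 2 < 6)%N V6).
rewrite mem_seq2 -in_set2 => z0S.
have [x [xS _ gx]] := pick z0 z0S; have [y [yS yx gy]] := pick x xS.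
have hx := gx; have hy := gy.
move: (xS) (yS); rewrite !inE !negb_or => /andP[xa xb] /andP[ya yb].
rewrite nbr // in hx; rewrite nbr // in hy.
move: hx hy => /andP[hax hbx] /andP[hay hby].
have un4 : uniq [:: x; y; a; b].
  by rewrite /= !inE !negb_or xa xb ya yb ab eq_sym yx.
(* A further neighbour would be a third common neighbour of [a] and [b] in [H], a [K_{2,3}]. *)
have only c : c \notin [:: x; y; a; b] -> ~~ adj G a c && ~~ adj G b c.
  rewrite !inE !negb_or => /and4P[cx cy ca cb].
  rewrite -negb_or nbr //; apply/negP => /andP[hac hbc].
  apply: (@common_neighbours_le2 H a b x y c outH) => //.
  rewrite /= !inE !negb_or ab eq_sym xa eq_sym ya /= [a == c]eq_sym ca.
  rewrite [b == x]eq_sym xb [b == y]eq_sym yb [b == c]eq_sym cb [x == y]eq_sym yx.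
  by rewrite [x == c]eq_sym cx [y == c]eq_sym cy.
have [u u4] := @exists_fresh [:: x; y; a; b] (leq_trans (isT : 4 < 6)%N V6).
(* The other three corners follow by exchanging [x] with [y] and [a] with [b]. *)
have gay := corner_adj hax hay only.
have gax : adj G a x.
  by apply: (corner_adj hay hax) => c nc; apply: only; rewrite !inE orbCA in nc *.
have only' c : c \notin [:: x; y; b; a] -> ~~ adj G b c && ~~ adj G a c.
  by rewrite andbC => nc; apply: only; rewrite !inE [(c == b) || _]orbC in nc *.
have gby := corner_adj hbx hby only'.
have gbx : adj G b x.
  by apply: (corner_adj hby hbx) => c nc; apply: only'; rewrite !inE orbCA in nc *.
by exfalso; apply: (no_pendant_square outG G2 un4 u4) only; rewrite adj_sym.
Qed.

End Comparison.

End Combinatorics.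

Local Close Scope ring_scope.
Local Close Scope classical_set_scope.

Theorem theorem3 (R : realType) (V : finType) (G H : sgraph V)
  (hV : 6 <= #|V|)
  (hG2 : k_connected G 2) (hH2 : k_connected H 2)
  (hGo : outerplanar R G) (hHo : outerplanar R H)
  (hGH : connected_triples G = connected_triples H) :
  edges G = edges H.
Proof.
suff adjE a b : adj G a b = adj H a b.
  rewrite /edges (_ : [set p | adj G p.1 p.2]%SET = [set p | adj H p.1 p.2]%SET) //.
  by apply/finset.setP => p; rewrite !inE.
apply/idP/idP; first exact: (adj_sub hV hG2 hH2 hGo hHo hGH).
exact: (adj_sub hV hH2 hG2 hHo hGo (esym hGH)).
Qed.
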